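(* Let $m,n\ge0$ be integers and put $m\wedge n=\min(m,n)$, $m\vee n=\max(m,n)$. For every $q\in\mathbb H\setminus\{0\}$, $$H^Q_{m,n}(q,\overline q)=\frac{(-1)^{m\wedge n}(m\vee n)!}{|m-n|!}\,\frac{q^m\overline q^{\,n}}{|q|^{2(m\wedge n)}}\;{}_1F_1\left(\begin{array}{c}-(m\wedge n)\\ |m-n|+1\end{array}\Big|\,|q|^2\right)=(-1)^{m\wedge n}(m\wedge n)!\,|q|^{-2(m\wedge n)}\,q^m\overline q^{\,n}\,L_{m\wedge n}^{(|m-n|)}(|q|^2).$$
   Context: $\mathbb H$ is the algebra of real quaternions, $\overline q$ the quaternionic conjugate, $|q|^2=q\overline q$. ${}_1F_1\left(\begin{array}{c}a\\c\end{array}\Big|\,t\right)=\sum_{k\ge0}\frac{(a)_k}{(c)_k}\frac{t^k}{k!}$ is the confluent hypergeometric function, with $(a)_k$ the rising factorial. $L_k^{(\alpha)}(t)=\sum_{i=0}^k(-1)^i\binom{k+\alpha}{k-i}\frac{t^i}{i!}$ are the generalized Laguerre polynomials. For integers $m,n\ge0$, $$H^Q_{m,n}(q,\overline q)=\sum_{k=0}^{\min(m,n)}(-1)^k k!\binom mk\binom nk q^{m-k}\overline q^{\,n-k}.$$ *)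

(* Defs.v *)
From HB Require Import structures.
From mathcomp Require Import all_boot all_order all_algebra.
From mathcomp Require Import ring.
From mathcomp Require Import all_classical all_reals all_analysis.

Set Implicit Arguments.
Unset Strict Implicit.
Unset Printing Implicit Defensive.

Import Order.TTheory GRing.Theory Num.Theory.
Import numFieldNormedType.Exports.

Local Open Scope ring_scope.

(* Quat a b c d stands for a + b i + c j + d k. *)
Record quat (R : Type) : Type := Quat { qre : R; qi : R; qj : R; qk : R }.

Section QuatAlgebra.
Variable R : comNzRingType.
Local Notation H := (quat R).
Implicit Types p q r : H.

Definition tuple_of_quat q : R * R * R * R := (qre q, qi q, qj q, qk q).
Definition quat_of_tuple (t : R * R * R * R) : H :=
  let: (a, b, c, d) := t in Quat a b c d.
Lemma tuple_of_quatK : cancel tuple_of_quat quat_of_tuple.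
Proof. by case. Qed.

HB.instance Definition _ := Choice.copy H (can_type tuple_of_quatK).

Definition quat_add p q : H :=
  Quat (qre p + qre q) (qi p + qi q) (qj p + qj q) (qk p + qk q).
Definition quat_opp q : H := Quat (- qre q) (- qi q) (- qj q) (- qk q).
Definition quat_zero : H := Quat 0 0 0 0.
Definition quat_one : H := Quat 1 0 0 0.
Definition quat_mul p q : H :=
  Quat (qre p * qre q - qi p * qi q - qj p * qj q - qk p * qk q)
       (qre p * qi q + qi p * qre q + qj p * qk q - qk p * qj q)
       (qre p * qj q - qi p * qk q + qj p * qre q + qk p * qi q)
       (qre p * qk q + qi p * qj q - qj p * qi q + qk p * qre q).
Definition quat_scale (a : R) q : H :=
  Quat (a * qre q) (a * qi q) (a * qj q) (a * qk q).

Lemma quat_addA : associative quat_add.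
Proof. by move=> p q r; rewrite /quat_add /= !addrA. Qed.
Lemma quat_addC : commutative quat_add.
Proof. by move=> p q; rewrite /quat_add; congr Quat; rewrite addrC. Qed.
Lemma quat_add0l : left_id quat_zero quat_add.
Proof. by case=> a b c d; rewrite /quat_add /= !add0r. Qed.
Lemma quat_addNl : left_inverse quat_zero quat_opp quat_add.
Proof. by move=> q; rewrite /quat_add /= !addNr. Qed.

HB.instance Definition _ := GRing.isZmodule.Build H
  quat_addA quat_addC quat_add0l quat_addNl.

Lemma quat_mulA : associative quat_mul.
Proof. by move=> p q r; rewrite /quat_mul /=; congr Quat; ring. Qed.
Lemma quat_mul1l : left_id quat_one quat_mul.
Proof. by case=> a b c d; rewrite /quat_mul /=; congr Quat; ring. Qed.
Lemma quat_mul1r : right_id quat_one quat_mul.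
Proof. by case=> a b c d; rewrite /quat_mul /=; congr Quat; ring. Qed.
Lemma quat_mulDl : left_distributive quat_mul quat_add.
Proof. by move=> p q r; rewrite /quat_mul /quat_add /=; congr Quat; ring. Qed.
Lemma quat_mulDr : right_distributive quat_mul quat_add.
Proof. by move=> p q r; rewrite /quat_mul /quat_add /=; congr Quat; ring. Qed.
Lemma quat_one_neq0 : quat_one != quat_zero.
Proof. by apply/eqP => -[] /eqP; rewrite oner_eq0. Qed.

HB.instance Definition _ := GRing.Zmodule_isNzRing.Build H
  quat_mulA quat_mul1l quat_mul1r quat_mulDl quat_mulDr quat_one_neq0.

Lemma quat_scaleA (a b : R) q :
  quat_scale a (quat_scale b q) = quat_scale (a * b) q.
Proof. by rewrite /quat_scale /= !mulrA. Qed.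
Lemma quat_scale1l : left_id 1 quat_scale.
Proof. by case=> a b c d; rewrite /quat_scale /= !mul1r. Qed.
Lemma quat_scaleDr : right_distributive quat_scale +%R.
Proof. by move=> a p q; rewrite /quat_scale /= !mulrDr. Qed.
Lemma quat_scaleDl q : {morph quat_scale^~ q : a b / a + b}.
Proof. by move=> a b; rewrite /quat_scale /= !mulrDl. Qed.

HB.instance Definition _ := GRing.Zmodule_isLmodule.Build R H
  quat_scaleA quat_scale1l quat_scaleDr quat_scaleDl.

Lemma quat_scaleAl (a : R) p q : a *: (p * q) = (a *: p) * q.
Proof.
by rewrite /GRing.scale /GRing.mul /= /quat_scale /quat_mul /=;
   congr Quat; ring.
Qed.
HB.instance Definition _ := GRing.Lmodule_isLalgebra.Build R H quat_scaleAl.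

Lemma quat_scaleAr (a : R) p q : a *: (p * q) = p * (a *: q).
Proof.
by rewrite /GRing.scale /GRing.mul /= /quat_scale /quat_mul /=;
   congr Quat; ring.
Qed.
HB.instance Definition _ := GRing.Lalgebra_isAlgebra.Build R H quat_scaleAr.

Definition quat_conj q : H := Quat (qre q) (- qi q) (- qj q) (- qk q).

End QuatAlgebra.

Definition quat_norm (R : rcfType) (q : quat R) : R :=
  Num.sqrt (qre q ^+ 2 + qi q ^+ 2 + qj q ^+ 2 + qk q ^+ 2).

Lemma quat_mul_conj (R : rcfType) (q : quat R) :
  q * quat_conj q = (quat_norm q ^+ 2)%:A.
Proof.
rewrite /quat_norm sqr_sqrtr ?addr_ge0 ?sqr_ge0 //.
case: q => a b c d.
by rewrite /GRing.scale /GRing.mul /= /quat_scale /quat_mul /=;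
   congr Quat; rewrite /=; ring.
Qed.

(* The rising factorial (a)_k. *)
Definition pochhammer (R : pzRingType) (a : R) (k : nat) : R :=
  \prod_(i < k) (a + i%:R).

(* Meaningful when c is not a nonpositive integer: the series then converges
   for every t. *)
Definition hyp1F1 (R : realType) (a c t : R) : R :=
  limn (series (fun k : nat =>
    pochhammer a k / pochhammer c k * (t ^+ k / k`!%:R))).

(* The binomial coefficient with an arbitrary (not only natural) top x. *)
Definition gbinom (R : fieldType) (x : R) (k : nat) : R :=
  (\prod_(i < k) (x - i%:R)) / k`!%:R.

Definition laguerre (R : fieldType) (k : nat) (alpha t : R) : R :=
  \sum_(i < k.+1) (-1) ^+ i * gbinom (k%:R + alpha) (k - i) * (t ^+ i / i`!%:R).

(* H^Q_{m,n}(q, conj q), as a function of q alone. *)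
Definition hermiteQ (R : comNzRingType) (m n : nat) (q : quat R) : quat R :=
  \sum_(k < (minn m n).+1)
    ((-1) ^+ k * (k`! * 'C(m, k) * 'C(n, k))%:R)
      *: (q ^+ (m - k) * quat_conj q ^+ (n - k)).

(* Main.v *)
Require Import Defs.
From mathcomp Require Import all_boot all_order all_algebra.
From mathcomp Require Import ring zify.
From mathcomp Require Import all_classical all_reals all_analysis.

Import Order.TTheory GRing.Theory Num.Theory.
Import numFieldNormedType.Exports.
Local Open Scope ring_scope.

(** The quaternion [q] commutes with its conjugate and [q * conj q] is the real
    scalar [t = |q|^2], which is invertible.  Hence each monomial
    [q^(m-k) conj(q)^(n-k)] is [t^-k] times the single quaternion
    [q^m conj(q)^n], and [hermiteQ m n q] is this quaternion times a real
    polynomial in [1/t] ([hermiteQ_laguerre]).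

    What remains is real.  With [s = min m n] and [d = |m - n|], the pair
    [(m, n)] is [(s, s + d)] up to order and the coefficients are symmetric in
    [m] and [n].  Reading the sum backwards, [k = s - i], turns the polynomial
    into [t^-s] times the Laguerre sum, because
    [i! (s-i)! 'C(s, s-i) = s!].
    The hypergeometric series has the negative integer [-s] as upper parameter,
    so it stops after [s + 1] terms ([hyp1F1_opp_nat]), and comparing
    coefficients identifies it with [s! d! / (s+d)!] times the same Laguerre
    polynomial ([hyp1F1_laguerre]).  Both equalities follow. *)

(** * Falling and rising factorials at integers *)

(** The subtraction on the left is that of the ring, not truncated; for [k > n]
    the product still vanishes, through its factor at [i = n]. *)
Lemma prod_natrB (R : pzRingType) (n k : nat) :
  \prod_(i < k) (n%:R - i%:R) = (n ^_ k)%:R :> R.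
Proof.
elim: k => [|k IHk]; first by rewrite big_ord0 ffactn0.
rewrite big_ord_recr /= IHk ffactnSr natrM.
have [le_kn | lt_nk] := leqP k n; first by rewrite natrB.
by rewrite ffact_small // !mul0r.
Qed.

Lemma pochhammer_opp_nat (R : comPzRingType) (n k : nat) :
  pochhammer (- n%:R : R) k = (-1) ^+ k * (n ^_ k)%:R.
Proof.
rewrite -prod_natrB -[X in (-1) ^+ X]card_ord -prodrN.
by apply: eq_bigr => i _; rewrite opprB addrC.
Qed.

Lemma pochhammer_natS (R : comPzRingType) (n k : nat) :
  pochhammer (n%:R + 1 : R) k * n`!%:R = (n + k)`!%:R.
Proof.
elim: k => [|k IHk]; first by rewrite /pochhammer big_ord0 mul1r addn0.
rewrite /pochhammer big_ord_recr /= mulrAC -/(pochhammer _ k) IHk.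
by rewrite addnS factS mulnC natrM -addrA (addrC 1) addrA -natrD natr1.
Qed.

Lemma gbinom_nat (R : numFieldType) (n k : nat) :
  gbinom (n%:R : R) k = 'C(n, k)%:R.
Proof.
by rewrite /gbinom prod_natrB -bin_ffact natrM mulfK // pnatr_eq0 -lt0n
           fact_gt0.
Qed.

(** * The terminating hypergeometric series and Laguerre polynomials *)

(** The factor [(-s)_k] contains [-s + s] as soon as [k > s], so the partial
    sums are constant from rank [s + 1] on. *)
Lemma hyp1F1_opp_nat (R : realType) (s : nat) (c t : R) :
  hyp1F1 (- s%:R) c t =
  \sum_(k < s.+1)
    pochhammer (- s%:R) k / pochhammer c k * (t ^+ k / k`!%:R).
Proof.
rewrite /hyp1F1; set u := fun k : nat => _.
have u0 k : (s < k)%N -> u k = 0.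
  by move=> lt_sk; rewrite /u pochhammer_opp_nat ffact_small // mulr0 !mul0r.
apply: cvg_lim => //; apply: cvg_near_cst.
exists s.+1 => // N /= le_sN; rewrite /series /= (big_cat_nat (leq0n _) le_sN) //=.
rewrite big_mkord [X in _ + X]big_nat [X in _ + X]big1 ?addr0 //.
by move=> k /andP[lt_sk _]; exact: u0.
Qed.

Lemma laguerre_nat (R : numFieldType) (s d : nat) (t : R) :
  laguerre s d%:R t =
  \sum_(i < s.+1) (-1) ^+ i * 'C(s + d, s - i)%:R * (t ^+ i / i`!%:R).
Proof. by apply: eq_bigr => i _; rewrite -natrD gbinom_nat. Qed.

Lemma hyp1F1_laguerre (R : realType) (s d : nat) (t : R) :
  (s + d)`!%:R / d`!%:R * hyp1F1 (- s%:R) (d%:R + 1) t =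
  s`!%:R * laguerre s d%:R t.
Proof.
have fact0 k : k`!%:R != 0 :> R by rewrite pnatr_eq0 -lt0n fact_gt0.
rewrite hyp1F1_opp_nat laguerre_nat !mulr_sumr; apply: eq_bigr => i _.
have le_is : (i <= s)%N by rewrite -ltnS.
have poch : pochhammer (d%:R + 1 : R) i = (d + i)`!%:R / d`!%:R.
  by rewrite -pochhammer_natS mulfK.
have ffE : (s ^_ i)%:R * (s - i)`!%:R = s`!%:R :> R.
  by rewrite -natrM ffact_fact.
have binE : 'C(s + d, s - i)%:R * ((s - i)`!%:R * (d + i)`!%:R)
            = (s + d)`!%:R :> R.
  rewrite -!natrM -(@bin_fact (s + d) (s - i)); last by lia.
  by have -> : (s + d - (s - i) = d + i)%N by lia.
rewrite pochhammer_opp_nat poch -ffE -binE.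
by field; rewrite !fact0.
Qed.

(** * Quaternionic Hermite polynomials *)

Lemma quat_norm_eq0 (R : rcfType) (q : quat R) : (quat_norm q == 0) = (q == 0).
Proof.
rewrite /quat_norm sqrtr_eq0.
case: q => a b c d /=; apply/idP/eqP => [le0|[-> -> -> ->]].
  have : a ^+ 2 + b ^+ 2 + c ^+ 2 + d ^+ 2 == 0.
    by rewrite eq_le le0 /= !addr_ge0 ?sqr_ge0.
  rewrite !paddr_eq0 ?addr_ge0 ?sqr_ge0 // !sqrf_eq0.
  by move=> /andP[/andP[/andP[/eqP-> /eqP->] /eqP->] /eqP->].
by rewrite expr0n /= !addr0.
Qed.

Lemma quat_commr_conj (R : comNzRingType) (q : quat R) :
  GRing.comm q (quat_conj q).
Proof.
rewrite /GRing.comm; case: q => a b c d.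
by rewrite /GRing.mul /= /quat_mul /=; congr Quat; ring.
Qed.

(** The [k] rightmost factors [q] meet the [k] leftmost factors [conj q], and
    since these commute, [q^k conj(q)^k = (q conj q)^k] is the real scalar
    [|q|^(2k)], which can be moved to the front. *)
Lemma quat_monomial_factor (R : rcfType) (q : quat R) (m n k : nat) :
  (k <= m)%N -> (k <= n)%N ->
  q ^+ m * quat_conj q ^+ n =
  (quat_norm q ^+ 2) ^+ k *: (q ^+ (m - k) * quat_conj q ^+ (n - k)).
Proof.
move=> le_km le_kn; rewrite -{1}(subnK le_km) -{1}(subnKC le_kn) !exprD.
rewrite -mulrA (mulrA (q ^+ k)) -exprMn_comm; last exact: quat_commr_conj.
by rewrite quat_mul_conj exprZn expr1n -scalerAl mul1r scalerAr.
Qed.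

(** With [mul_bin_minn_maxn], this spares any case distinction between [m <= n]
    and [n <= m]: the real coefficients depend on [s] and [d] only. *)
Lemma maxn_minn_dist (m n : nat) :
  (maxn m n = minn m n + `|m%:Z - n%:Z|)%N.
Proof. lia. Qed.

Lemma mul_bin_minn_maxn (m n k : nat) :
  ('C(m, k) * 'C(n, k) = 'C(minn m n, k) * 'C(maxn m n, k))%N.
Proof. by case: (leqP m n) => //; rewrite mulnC. Qed.

(** The term of index [k] is [t^-k = t^-s t^(s-k)] times [q^m conj(q)^n], with
    [t = |q|^2], so the index of the Laguerre sum is [i = s - k]. *)
Lemma hermiteQ_laguerre (R : realType) (m n : nat) (q : quat R) : q != 0 ->
  let s := minn m n in
  let d := `|m%:Z - n%:Z|%N in
  hermiteQ m n q =
  ((-1) ^+ s * s`!%:R * quat_norm q ^- (2 * s)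
     * laguerre s d%:R (quat_norm q ^+ 2))
  *: (q ^+ m * quat_conj q ^+ n).
Proof.
move=> q0 s d; rewrite exprM; set t := quat_norm q ^+ 2.
have t0 : t != 0 by rewrite expf_neq0 // quat_norm_eq0.
rewrite laguerre_nat mulr_sumr scaler_suml /hermiteQ (reindex_inj rev_ord_inj).
apply: eq_bigr => i _ /=; rewrite -/s subSS.
have le_is : (i <= s)%N by rewrite -ltnS.
have [le_m le_n] : (s - i <= m)%N /\ (s - i <= n)%N by lia.
rewrite (quat_monomial_factor R q m n (s - i) le_m le_n) -/t scalerA.
congr (_ *: _).
rewrite -mulnA mul_bin_minn_maxn maxn_minn_dist -/s -/d.
have factE : (s - i)`!%:R * ('C(s, s - i)%:R * i`!%:R) = s`!%:R :> R.
  by rewrite -!natrM -(bin_fact (leq_subr i s)) subKn // mulnCA.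
have signE : (-1) ^+ (s - i) = (-1) ^+ s * (-1) ^+ i :> R.
  by rewrite -{2}(subnK le_is) exprD -mulrA -exprMn mulrNN mulr1 expr1n mulr1.
have tE : t ^+ s = t ^+ (s - i) * t ^+ i by rewrite -exprD subnK.
rewrite signE -factE tE !natrM.
field.
by rewrite pnatr_eq0 -lt0n fact_gt0 !(expf_neq0 _ t0).
Qed.

Theorem lemma3p2 (R : realType) (m n : nat) (q : quat R) (hq : q != 0) :
  hermiteQ m n q
  = ((-1) ^+ minn m n * (maxn m n)`!%:R / `|m%:Z - n%:Z|%N`!%:R)
      *: (quat_norm q ^- (2 * minn m n) *: (q ^+ m * quat_conj q ^+ n))
    * (hyp1F1 (- (minn m n)%:R) (`|m%:Z - n%:Z|%N%:R + 1)
         (quat_norm q ^+ 2))%:A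
  /\
  ((-1) ^+ minn m n * (maxn m n)`!%:R / `|m%:Z - n%:Z|%N`!%:R)
    *: (quat_norm q ^- (2 * minn m n) *: (q ^+ m * quat_conj q ^+ n))
  * (hyp1F1 (- (minn m n)%:R) (`|m%:Z - n%:Z|%N%:R + 1)
       (quat_norm q ^+ 2))%:A
  = ((-1) ^+ minn m n * (minn m n)`!%:R * quat_norm q ^- (2 * minn m n))
      *: (q ^+ m * quat_conj q ^+ n)
    * (laguerre (minn m n) `|m%:Z - n%:Z|%N%:R (quat_norm q ^+ 2))%:A.
Proof.
have scale_mulA (a b : R) (x : quat R) : a *: x * b%:A = (a * b) *: x.
  by rewrite mulr_algr scalerA mulrC.
have hypE := hyp1F1_laguerre R (minn m n) `|m%:Z - n%:Z|%N (quat_norm q ^+ 2).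
rewrite -maxn_minn_dist in hypE.
have hyp_lag :
  ((-1) ^+ minn m n * (maxn m n)`!%:R / `|m%:Z - n%:Z|%N`!%:R)
    *: (quat_norm q ^- (2 * minn m n) *: (q ^+ m * quat_conj q ^+ n))
  * (hyp1F1 (- (minn m n)%:R) (`|m%:Z - n%:Z|%N%:R + 1)
       (quat_norm q ^+ 2))%:A
  = ((-1) ^+ minn m n * (minn m n)`!%:R * quat_norm q ^- (2 * minn m n))
      *: (q ^+ m * quat_conj q ^+ n)
    * (laguerre (minn m n) `|m%:Z - n%:Z|%N%:R (quat_norm q ^+ 2))%:A.
  rewrite scalerA !scale_mulA; congr (_ *: _).
  by rewrite -[X in X / _]mulrA mulrAC -!(mulrA ((-1) ^+ _)) hypE; ring.
split=> //.
by rewrite hyp_lag scale_mulA; exact: hermiteQ_laguerre.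
Qed.
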